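(* Let $\widetilde K\in\widetilde{\mathcal K}_{\mathcal S}$ be a common stabilizing controller and let $(\mathcal T^{(i)},\mathcal T^{(j)})$ be a pair of distinct LQG tasks from the training set $\mathcal S$. Let $M\in\mathbb S_+^{2n_x^2}$ (symmetric positive semidefinite, of size $2n_x^2\times 2n_x^2$) and $\lambda\in(0,1)$ satisfy $$M\succeq C_{\widetilde K}^{(ij)\top}C_{\widetilde K}^{(ij)},\qquad F_{\widetilde K}^{(ij)\top}MF_{\widetilde K}^{(ij)}-M\preceq-\lambda M,$$ where $C_{\widetilde K}^{(ij)}:=[\,C_{\widetilde K}^{(i)}\;\;-C_{\widetilde K}^{(j)}\,]$ and $F_{\widetilde K}^{(ij)}:=\mathrm{diag}(F_{\widetilde K}^{(i)},F_{\widetilde K}^{(j)})$ (block diagonal). Fix $\eta\in\left(0,\frac{\lambda}{1-\lambda}\right)$ and set $\zeta:=1+\eta^{-1}$, $\lambda':=\lambda-\eta(1-\lambda)$. Then the quadratic function $V:\mathbb R^{n_x^2}\times\mathbb R^{n_x^2}\to\mathbb R_+$, $$V(s^{(i)},s^{(j)}):=\begin{bmatrix}s^{(i)}\\ s^{(j)}\end{bmatrix}^\top M\begin{bmatrix}s^{(i)}\\ s^{(j)}\end{bmatrix},$$ is a bisimulation function between the systems $S_{\widetilde K}^{(i)}$ and $S_{\widetilde K}^{(j)}$ (with these constants $\lambda'$ and $\zeta$), implying $$\epsilon_{\mathrm{het}}^{(ij)}(\widetilde K)\le\frac{\zeta\,\nu^{(ij)\top}M\nu^{(ij)}}{\lambda'},\qquad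 \nu^{(ij)}:=\begin{bmatrix}\nu^{(i)}\\ \nu^{(j)}\end{bmatrix}.$$
   Context: **Tasks.** An LQG task is a tuple $\mathcal T^{(i)}=(A^{(i)},B^{(i)},C^{(i)},W^{(i)},V^{(i)},Q^{(i)},R^{(i)})$ defining $x_{t+1}^{(i)}=A^{(i)}x_t^{(i)}+B^{(i)}u_t^{(i)}+w_t^{(i)}$, $y_t^{(i)}=C^{(i)}x_t^{(i)}+v_t^{(i)}$, $x_0^{(i)}=0$, with state in $\mathbb R^{n_x}$, input in $\mathbb R^{n_u}$, output in $\mathbb R^{n_y}$; the noises $w_t^{(i)}\sim\mathcal N(0,W^{(i)})$, $v_t^{(i)}\sim\mathcal N(0,V^{(i)})$ are i.i.d. in time, mutually independent, independent across tasks, $W^{(i)}\succeq0$, $V^{(i)}\succ0$; $Q^{(i)}\succeq0$, $R^{(i)}\succ0$. Each $(A^{(i)},B^{(i)})$ is controllable and $(A^{(i)},C^{(i)})$ observable. The cost is $J^{(i)}=\limsup_{T\to\infty}\frac1T\mathbb E\sum_{t=0}^{T-1}(y_t^{(i)\top}Q^{(i)}y_t^{(i)}+u_t^{(i)\top}R^{(i)}u_t^{(i)})$. The training set is $\mathcal S=\{\mathcal T^{(i)}\}_{i=1}^N$. **Lifted controllers.** Fix a history length $p\in\mathbb N$ and let $z_{t,p}^{(i)}\in\mathbb R^{p(n_u+n_y)}$ stack $u_{t-1}^{(i)},\dots,u_{t-p}^{(i)},y_t^{(i)},\dots,y_{t-p+1}^{(i)}$. $S_\star^{(i)}\in\mathbb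 R^{n_x\times p(n_u+n_y)}$ is a fixed task-dependent matrix (determined by the task parameters, the Kalman gain and the optimal LQG gain) with $\widehat x_t^{(i)}=S_\star^{(i)}z_{t,p}^{(i)}$, where $\widehat x_t^{(i)}$ is the Kalman filter state estimate; $\dagger$ denotes the pseudoinverse. A lifted controller $\widetilde K\in\mathbb R^{n_u\times p(n_u+n_y)}$ defines the policy $u_t^{(i)}=\widetilde Kz_{t,p}^{(i)}$, corresponding to the gain $K=\widetilde KS_\star^{(i)\dagger}$ on the estimate; $J^{(i)}(\widetilde K)$ is the resulting cost. Let $A_{\widetilde K}^{(i)}:=A^{(i)}+B^{(i)}\widetilde KS_\star^{(i)\dagger}$, $\widetilde{\mathcal K}^{(i)}:=\{\widetilde K:\rho(A_{\widetilde K}^{(i)})<1\}$ and $\widetilde{\mathcal K}_{\mathcal S}:=\bigcap_{i=1}^N\widetilde{\mathcal K}^{(i)}$. **Gradient.** $\mathtt{dare}(A,B,Q,R)$ is the unique stabilizing solution $P$ of $P=Q+A^\top PA-A^\top PB(R+B^\top PB)^{-1}B^\top PA$. Let $\widetilde\Sigma^{(i)}=\mathtt{dare}(A^{(i)\top},C^{(i)\top},W^{(i)},V^{(i)})$, $L^{(i)}=\widetilde\Sigma^{(i)}C^{(i)\top}(C^{(i)}\widetilde\Sigma^{(i)}C^{(i)\top}+V^{(i)})^{-1}$, $\Sigma_\nu^{(i)}=L^{(i)}(C^{(i)}\widetilde\Sigma^{(i)}C^{(i)\top}+V^{(i)})L^{(i)\top}$, $\widetilde Q^{(i)}=C^{(i)\top}Q^{(i)}C^{(i)}$.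 For $\widetilde K\in\widetilde{\mathcal K}^{(i)}$, $P_{\widetilde K}^{(i)}$ and $\Sigma_{\widetilde K}^{(i)}$ are the unique solutions of $P=\widetilde Q^{(i)}+S_\star^{(i)\dagger\top}\widetilde K^\top R^{(i)}\widetilde KS_\star^{(i)\dagger}+A_{\widetilde K}^{(i)\top}PA_{\widetilde K}^{(i)}$ and $\Sigma=\Sigma_\nu^{(i)}+A_{\widetilde K}^{(i)}\Sigma A_{\widetilde K}^{(i)\top}$. Put $E_{\widetilde K}^{(i)}:=2\big((R^{(i)}+B^{(i)\top}P_{\widetilde K}^{(i)}B^{(i)})\widetilde KS_\star^{(i)\dagger}+B^{(i)\top}P_{\widetilde K}^{(i)}A^{(i)}\big)$. The gradient is $\nabla J^{(i)}(\widetilde K)=E_{\widetilde K}^{(i)}\Sigma_{\widetilde K}^{(i)}S_\star^{(i)\dagger\top}$. The gradient heterogeneity is $\epsilon_{\mathrm{het}}^{(ij)}(\widetilde K):=\|\nabla J^{(i)}(\widetilde K)-\nabla J^{(j)}(\widetilde K)\|_F^2$. **Gradient system.** $S_{\widetilde K}^{(i)}$ is the linear system $s_{\widetilde K,t+1}^{(i)}=F_{\widetilde K}^{(i)}s_{\widetilde K,t}^{(i)}+\nu^{(i)}$, $z_{\widetilde K,t}^{(i)}=C_{\widetilde K}^{(i)}s_{\widetilde K,t}^{(i)}$, with state in $\mathbb R^{n_x^2}$, $F_{\widetilde K}^{(i)}=A_{\widetilde K}^{(i)}\otimes A_{\widetilde K}^{(i)}$, $C_{\widetilde K}^{(i)}=S_\star^{(i)\dagger}\otimes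 E_{\widetilde K}^{(i)}$, $\nu^{(i)}=\mathrm{vec}(\Sigma_\nu^{(i)})$. **Bisimulation function.** A continuous $V:\mathbb R^{n_x^2}\times\mathbb R^{n_x^2}\to\mathbb R_+$ is a bisimulation function between $S_{\widetilde K}^{(i)}$ and $S_{\widetilde K}^{(j)}$ if there exist $\lambda'\in(0,2)$, $\zeta>0$ such that for all pairs of states $(s^{(i)},s^{(j)})$: (a) $V(s^{(i)},s^{(j)})\ge\|C_{\widetilde K}^{(i)}s^{(i)}-C_{\widetilde K}^{(j)}s^{(j)}\|^2$; (b) $V(F_{\widetilde K}^{(i)}s^{(i)}+\nu^{(i)},F_{\widetilde K}^{(j)}s^{(j)}+\nu^{(j)})-V(s^{(i)},s^{(j)})\le-\lambda'V(s^{(i)},s^{(j)})+\zeta V(\nu^{(i)},\nu^{(j)})$. *)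

(* Defs.v *)
From mathcomp Require Import all_boot all_order all_algebra.
From mathcomp Require Import complex mxtens.
From mathcomp Require Import all_classical all_reals all_analysis.
Set Implicit Arguments.
Unset Strict Implicit.
Unset Printing Implicit Defensive.
Import Order.TTheory GRing.Theory Num.Theory.
Import numFieldNormedType.Exports.
Local Open Scope classical_set_scope.
Local Open Scope ring_scope.

Section MatrixNotions.
Variable R : realType.

(* Frobenius norm; on column vectors it is the Euclidean norm.  (The norm
   `|A| of MathComp-Analysis on matrices is the sup norm.) *)
Definition fnorm m n (A : 'M[R]_(m, n)) : R :=
  Num.sqrt (\sum_i \sum_j A i j ^+ 2).

Definition qform n (A : 'M[R]_n) (x : 'cV[R]_n) : R := (x^T *m A *m x) 0 0.

Definition psd n (A : 'M[R]_n) : Prop := A^T = A /\ forall x, 0 <= qform A x.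

Definition posdef n (A : 'M[R]_n) : Prop :=
  A^T = A /\ forall x, x != 0 -> 0 < qform A x.

Definition loewner_le n (A B : 'M[R]_n) : Prop := psd (B - A).

(* The largest modulus of a complex eigenvalue of A; 0 when n = 0. *)
Definition spectral_radius n (A : 'M[R]_n) : R :=
  sup [set Normc.normc z | z in
        [set z : complex R | eigenvalue (map_mx (real_complex R) A) z]].

Definition is_pseudoinverse m n (A : 'M[R]_(m, n)) (X : 'M[R]_(n, m)) : Prop :=
  [/\ A *m X *m A = A, X *m A *m X = X,
      (A *m X)^T = A *m X & (X *m A)^T = X *m A].

(* Moore-Penrose inverse; the library's [pinvmx] is only a partial inverse and
   does not satisfy the two symmetry conditions. *)
Definition pseudoinverse m n (A : 'M[R]_(m, n)) : 'M[R]_(n, m) :=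
  xget 0 [set X | is_pseudoinverse A X].

(* Column-stacking vec: entry (i, j) goes to position j * m + i.  The indexing
   is that of the Kronecker product [*t], so that
   (B *t A) *m vec X = vec (A *m X *m B^T). *)
Definition vec m n (X : 'M[R]_(m, n)) : 'cV[R]_(n * m) :=
  \col_k X (mxtens_unindex k).2 (mxtens_unindex k).1.

Definition stack p n (f : nat -> 'cV[R]_n) : 'cV[R]_(p * n) :=
  \col_k f (mxtens_unindex k).1 (mxtens_unindex k).2 0.

Definition controllable n m (A : 'M[R]_n) (B : 'M[R]_(n, m)) : Prop :=
  \rank (\mxrow_(k < n) (A ^+ k *m B)) = n.

Definition observable n m (A : 'M[R]_n) (C : 'M[R]_(m, n)) : Prop :=
  \rank (\mxcol_(k < n) (C *m A ^+ k)) = n.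

Definition riccati_gain n m (A : 'M[R]_n) (B : 'M[R]_(n, m)) (Rm : 'M[R]_m)
    (P : 'M[R]_n) : 'M[R]_(m, n) :=
  invmx (Rm + B^T *m P *m B) *m B^T *m P *m A.

(* [invmx] is the identity on singular matrices, whence the invertibility
   requirement. *)
Definition is_dare n m (A : 'M[R]_n) (B : 'M[R]_(n, m)) (Q : 'M[R]_n)
    (Rm : 'M[R]_m) (P : 'M[R]_n) : Prop :=
  [/\ P^T = P, Rm + B^T *m P *m B \in unitmx,
      P = Q + A^T *m P *m A
          - A^T *m P *m B *m invmx (Rm + B^T *m P *m B) *m B^T *m P *m A
    & spectral_radius (A - B *m riccati_gain A B Rm P) < 1].

(* The stabilizing solution is unique when it exists; junk value 0 otherwise. *)
Definition dare n m (A : 'M[R]_n) (B : 'M[R]_(n, m)) (Q : 'M[R]_n)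
    (Rm : 'M[R]_m) : 'M[R]_n :=
  xget 0 [set P | is_dare A B Q Rm P].

End MatrixNotions.

Record lqg_task (R : realType) (nx nu ny : nat) := LQGTask {
  tA : 'M[R]_nx;
  tB : 'M[R]_(nx, nu);
  tC : 'M[R]_(ny, nx);
  tW : 'M[R]_nx;
  tV : 'M[R]_ny;
  tQ : 'M[R]_ny;
  tR : 'M[R]_nu;
  tW_psd : psd tW;
  tV_posdef : posdef tV;
  tQ_psd : psd tQ;
  tR_posdef : posdef tR;
  tAB_controllable : controllable tA tB;
  tAC_observable : observable tA tC }.

Section Task.
Variables (R : realType) (nx nu ny p : nat) (T : lqg_task R nx nu ny).
Local Notation A := (tA T).
Local Notation B := (tB T).
Local Notation C := (tC T).

Definition Sigma_tilde : 'M[R]_nx := dare A^T C^T (tW T) (tV T).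

Definition innov_cov : 'M[R]_ny := C *m Sigma_tilde *m C^T + tV T.

Definition kalman_gain : 'M[R]_(nx, ny) :=
  Sigma_tilde *m C^T *m invmx innov_cov.

Definition Sigma_nu : 'M[R]_nx := kalman_gain *m innov_cov *m kalman_gain^T.

Definition Q_tilde : 'M[R]_nx := C^T *m tQ T *m C.

Definition lqg_gain : 'M[R]_(nu, nx) :=
  - riccati_gain A B (tR T) (dare A B Q_tilde (tR T)).

(* z_t = (u_(t-1), ..., u_(t-p), y_t, ..., y_(t-p+1)), meaningful for p <= t. *)
Definition history (u : nat -> 'cV[R]_nu) (y : nat -> 'cV[R]_ny) (t : nat) :
    'cV[R]_(p * (nu + ny)) :=
  castmx (esym (mulnDr p nu ny), erefl 1%N)
    (col_mx (stack p (fun k => u (t - k.+1)%N))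
            (stack p (fun k => y (t - k)%N))).

(* Sample path of the plant and its steady-state Kalman filter in closed loop
   with the optimal LQG gain, for the noise realizations w and v. *)
Definition lqg_trajectory (x : nat -> 'cV[R]_nx) (u : nat -> 'cV[R]_nu)
    (y : nat -> 'cV[R]_ny) (xhat : nat -> 'cV[R]_nx)
    (w : nat -> 'cV[R]_nx) (v : nat -> 'cV[R]_ny) : Prop :=
  [/\ x 0%N = 0 /\ (forall t, x t.+1 = A *m x t + B *m u t + w t),
      forall t, y t = C *m x t + v t,
      xhat 0%N = 0 /\ (forall t, xhat t.+1 = A *m xhat t + B *m u t
        + kalman_gain *m (y t.+1 - C *m (A *m xhat t + B *m u t)))
    & forall t, u t = lqg_gain *m xhat t].

(* Defining property of S_star.  Recovering the estimate from a window of
   inputs and outputs uses the knowledge of the gain that produced the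
   inputs, here the optimal LQG gain. *)
Definition is_history_lift (S : 'M[R]_(nx, p * (nu + ny))) : Prop :=
  forall x u y xhat w v, lqg_trajectory x u y xhat w v ->
    forall t, (p <= t)%N -> xhat t = S *m history u y t.

Variables (S : 'M[R]_(nx, p * (nu + ny))) (K : 'M[R]_(nu, p * (nu + ny))).

(* The gain on the state estimate induced by the lifted controller K. *)
Definition eff_gain : 'M[R]_(nu, nx) := K *m pseudoinverse S.

Definition A_cl : 'M[R]_nx := A + B *m eff_gain.

Definition stabilizing : Prop := spectral_radius A_cl < 1.

Definition P_cl : 'M[R]_nx :=
  xget 0 [set P | P = Q_tilde + eff_gain^T *m tR T *m eff_gain
                      + A_cl^T *m P *m A_cl].

Definition Sigma_cl : 'M[R]_nx :=
  xget 0 [set X | X = Sigma_nu + A_cl *m X *m A_cl^T].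

Definition E_cl : 'M[R]_(nu, nx) :=
  2%:R *: ((tR T + B^T *m P_cl *m B) *m eff_gain + B^T *m P_cl *m A).

(* The closed form of the policy gradient of the LQG cost. *)
Definition gradJ : 'M[R]_(nu, p * (nu + ny)) :=
  E_cl *m Sigma_cl *m (pseudoinverse S)^T.

End Task.

(* s_(t+1) = F s_t + nu,  z_t = C s_t. *)
Record affine_system (R : realType) (n m : nat) := AffineSystem {
  sysF : 'M[R]_n;
  sysC : 'M[R]_(m, n);
  sysnu : 'cV[R]_n }.

Definition gradient_system (R : realType) nx nu ny p (T : lqg_task R nx nu ny)
    (S : 'M[R]_(nx, p * (nu + ny))) (K : 'M[R]_(nu, p * (nu + ny))) :
    affine_system R (nx * nx) (p * (nu + ny) * nu) :=
  AffineSystem (tensmx (A_cl T S K) (A_cl T S K))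
               (tensmx (pseudoinverse S) (E_cl T S K))
               (vec (Sigma_nu T)).

Section Bisimulation.
Variables (R : realType) (n m : nat) (S1 S2 : affine_system R n m).

Definition bisimulation_with (lam zeta : R) (V : 'cV[R]_n * 'cV[R]_n -> R) :
    Prop :=
  [/\ continuous V, forall s, 0 <= V s, 0 < lam < 2, 0 < zeta
    & forall s1 s2,
        fnorm (sysC S1 *m s1 - sysC S2 *m s2) ^+ 2 <= V (s1, s2) /\
        V (sysF S1 *m s1 + sysnu S1, sysF S2 *m s2 + sysnu S2) - V (s1, s2)
          <= - lam * V (s1, s2) + zeta * V (sysnu S1, sysnu S2)].

Definition bisimulation_function (V : 'cV[R]_n * 'cV[R]_n -> R) : Prop :=
  exists lam zeta : R, bisimulation_with lam zeta V.

Definition joint_C : 'M[R]_(m, n + n) := row_mx (sysC S1) (- sysC S2).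

Definition joint_F : 'M[R]_(n + n) := block_mx (sysF S1) 0 0 (sysF S2).

Definition joint_nu : 'cV[R]_(n + n) := col_mx (sysnu S1) (sysnu S2).

End Bisimulation.

Definition gradient_heterogeneity (R : realType) nx nu ny p
    (T1 T2 : lqg_task R nx nu ny) (S1 S2 : 'M[R]_(nx, p * (nu + ny)))
    (K : 'M[R]_(nu, p * (nu + ny))) : R :=
  fnorm (gradJ T1 S1 K - gradJ T2 S2 K) ^+ 2.

(* Main.v *)
(* The vectorised stationary covariance is a fixed point of each gradient
   system, and the output map sends it to the vectorised gradient.  At a pair of
   fixed points the decrease condition (b) of a bisimulation function reads
   lam' V <= zeta V(nu), so the output bound (a) alone gives the heterogeneity
   bound, without any convergence argument.  The covariance exists because
   X |-> X - A X A^T is injective when no two complex eigenvalues of A have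
   product 1. *)
Require Import Defs.
From HB Require Import structures.
From mathcomp Require Import all_boot all_order all_algebra.
From mathcomp Require Import complex mxtens ring lra.
From mathcomp Require Import all_classical all_reals all_analysis.
Set Implicit Arguments.
Unset Strict Implicit.
Unset Printing Implicit Defensive.
Import Order.TTheory GRing.Theory Num.Theory.
Import numFieldNormedType.Exports.
Local Open Scope classical_set_scope.
Local Open Scope ring_scope.

(** * Stein and Lyapunov equations *)

(* With Y = A Y B, (A - a) Y = 0 implies Y (1 - a B) = (Y - a Y B) = (A - a) Y B = 0,
   hence Y = 0: the factors of the characteristic polynomial of A are cancelled
   one at a time, down from Cayley-Hamilton. *)
Lemma stein_unique (F : closedFieldType) n (A B X : 'M[F]_n) :
  (forall a b, eigenvalue A a -> eigenvalue B b -> a * b != 1) ->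
  X = A *m X *m B -> X = 0.
Proof.
case: n A B X => [|n] A B X hAB hX; first exact: flatmx0.
have [s hs] := closed_field_poly_normal (char_poly A).
rewrite (monicP (char_poly_monic A)) scale1r in hs.
(* A nonzero row [v] with [v = a v B] forces [a != 0] and makes [a^-1] an eigenvalue of [B], against
   [hAB]. *)
have hu a : a \in s -> row_free (1%:M - a *: B).
  move=> sa; apply: inj_row_free => v.
  rewrite mulmxBr mulmx1 -scalemxAr => /eqP; rewrite subr_eq0 => /eqP hv.
  apply/eqP/negPn/negP => v0.
  have a0 : a != 0 by apply: contraNneq v0 => a0; rewrite hv a0 scale0r.
  have hAa : eigenvalue A a.
    by rewrite eigenvalue_root_char hs root_prod_XsubC.
  have hBa : eigenvalue B a^-1.
    apply/eigenvalueP; exists v => //.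
    by rewrite {2}hv scalerA mulVf // scale1r.
  by have := hAB _ _ hAa hBa; rewrite divff ?eqxx.
(* Generalised over [Y]: the induction passes from [Y] to [(A - a) Y], again a solution because [A]
   commutes with [A - a]. *)
suff: forall Y : 'M[F]_n.+1, Y = A *m Y *m B ->
    horner_mx A (\prod_(z <- s) ('X - z%:P)) *m Y = 0 -> Y = 0.
  by apply; rewrite // -hs Cayley_Hamilton mul0mx.
elim: s hu {hs} => [|a s IHs] hu Y hY.
  by rewrite big_nil rmorph1 mul1mx.
rewrite big_cons mulrC rmorphM /= -mulmxE -mulmxA => h.
have : (horner_mx A ('X - a%:P) *m Y) = 0.
  apply: IHs h; first by move=> z zs; apply: hu; rewrite inE zs orbT.
  rewrite {1}hY !mulmxA; congr (_ *m _ *m _).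
  by rewrite rmorphB /= horner_mx_X horner_mx_C mulmxBl mulmxBr scalar_mxC.
rewrite rmorphB /= horner_mx_X horner_mx_C => h2.
apply: (row_free_inj (hu a (mem_head _ _))).
rewrite mul0mx mulmxBr mulmx1 -scalemxAr {1}hY -[RHS](mul0mx _ B) -h2.
by rewrite !mulmxBl mul_scalar_mx -scalemxAl.
Qed.

Lemma eigenvalue_tr (F : fieldType) n (A : 'M[F]_n) a :
  eigenvalue A^T a = eigenvalue A a.
Proof.
rewrite !eigenvalue_root_char; congr (root _ a).
rewrite /char_poly -[RHS]det_tr; congr (\det _).
by apply/matrixP => i j; rewrite !mxE eq_sym.
Qed.

Lemma normc_nneg (R : rcfType) (z : complex R) : 0 <= Normc.normc z.
Proof. by case: z => a b; exact: sqrtr_ge0. Qed.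

Lemma eigenvalue_le_spectral_radius (R : realType) n (A : 'M[R]_n)
    (z : complex R) :
  eigenvalue (map_mx (real_complex R) A) z ->
  Normc.normc z <= spectral_radius A.
Proof.
move=> hz; apply: ub_le_sup; last by exists z.
have [s hs] := closed_field_poly_normal (char_poly (map_mx (real_complex R) A)).
rewrite (monicP (char_poly_monic _)) scale1r in hs.
(* [sup] dominates its set only once that set is bounded; the sum of the moduli of all roots is a
   bound. *)
exists (\sum_(y <- s) Normc.normc y) => _ [y /= hy <-].
have ys : y \in s by move: hy; rewrite eigenvalue_root_char hs root_prod_XsubC.
by rewrite (big_rem _ ys) /= lerDl sumr_ge0 // => u _; exact: normc_nneg.
Qed.

(** An injective linear endomorphism of a finite-dimensional space is onto, so [X - A X A^T] takes
    the value [Q]. Injectivity is checked over the complex numbers, where a product of two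
    eigenvalues has modulus below 1. *)
Lemma lyapunov_solvable (R : realType) n (A Q : 'M[R]_n) :
  spectral_radius A < 1 -> exists X : 'M[R]_n, X = Q + A *m X *m A^T.
Proof.
move=> hA.
pose f X := X - A *m X *m A^T.
have f_lin : linear f.
  move=> c X Y; rewrite /f mulmxDr mulmxDl -scalemxAr -scalemxAl scalerBr.
  by rewrite opprD addrACA.
pose fL := HB.pack_for {linear 'M[R]_n -> 'M[R]_n} f
  (GRing.isLinear.Build R 'M[R]_n 'M[R]_n _ f f_lin).
have f_inj : forall X, f X = 0 -> X = 0.
  move=> X /eqP; rewrite subr_eq0 => /eqP hX.
  apply/eqP; rewrite -(map_mx_eq0 (real_complex R)); apply/eqP.
  apply: (@stein_unique _ _ (map_mx (real_complex R) A)
    (map_mx (real_complex R) A^T)); last by rewrite -!map_mxM -hX.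
  move=> a b ha; rewrite -map_trmx eigenvalue_tr => hb.
  apply/eqP => /(congr1 (@Normc.normc R)); rewrite Normc.normcM Normc.normc1.
  apply/eqP; rewrite lt_eqF //.
  have ha1 := le_lt_trans (eigenvalue_le_spectral_radius ha) hA.
  have hb1 := le_lt_trans (eigenvalue_le_spectral_radius hb) hA.
  apply: le_lt_trans hb1; apply: ler_piMl; [exact: normc_nneg | exact: ltW].
have : lin_mx fL \in unitmx.
  rewrite -row_free_unit; apply: inj_row_free => v hv.
  apply: (can_inj vec_mxK); rewrite linear0; apply: f_inj.
  by rewrite -[f _]/(fL _) -mx_rV_lin hv linear0.
move=> hu; exists (vec_mx (mxvec Q *m invmx (lin_mx fL))).
apply/eqP; rewrite -subr_eq; apply/eqP.
rewrite -[LHS]/(fL _) -mx_rV_lin mulmxKV // mxvecK //.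
Qed.

(** * Vectorisation and Kronecker products *)

(** Both maps of a gradient system have this form: [X |-> A_cl X A_cl^T] for the state,
    [X |-> E_cl X (pseudoinverse S)^T] for the output. *)
Lemma tensmx_vec (R : realType) m n p q (A : 'M[R]_(m, n)) (B : 'M[R]_(p, q))
    (X : 'M[R]_(q, n)) :
  tensmx A B *m vec X = vec (B *m X *m A^T).
Proof.
apply/matrixP => k l; rewrite !mxE.
under [RHS]eq_bigr => i _ do rewrite !mxE mulr_suml.
rewrite pair_big /= (reindex (@mxtens_unindex n q)) /=; last first.
  exists (@mxtens_index n q) => x _; first exact: mxtens_unindexK.
  exact: mxtens_indexK.
by apply: eq_bigr => i _; rewrite !mxE -mulrA mulrC.
Qed.

Lemma vecD (R : realType) m n (X Y : 'M[R]_(m, n)) : vec (X + Y) = vec X + vec Y.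
Proof. by apply/matrixP => k l; rewrite !mxE. Qed.

Lemma vecB (R : realType) m n (X Y : 'M[R]_(m, n)) : vec (X - Y) = vec X - vec Y.
Proof. by apply/matrixP => k l; rewrite !mxE. Qed.

Lemma fnorm_vec (R : realType) m n (X : 'M[R]_(m, n)) : fnorm (vec X) = fnorm X.
Proof.
rewrite /fnorm; congr Num.sqrt; rewrite [RHS]exchange_big pair_big /=.
rewrite (reindex (@mxtens_unindex n m)) /=; last first.
  exists (@mxtens_index n m) => x _; first exact: mxtens_unindexK.
  exact: mxtens_indexK.
by apply: eq_bigr => k _; rewrite big_ord1 mxE.
Qed.

Lemma fnorm_sqr (R : realType) n (x : 'cV[R]_n) : fnorm x ^+ 2 = (x^T *m x) 0 0.
Proof.
rewrite /fnorm sqr_sqrtr; last first.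
  by rewrite sumr_ge0 // => i _; rewrite sumr_ge0 // => j _; rewrite sqr_ge0.
by rewrite mxE; apply: eq_bigr => i _; rewrite big_ord1 mxE expr2.
Qed.

(** * Quadratic forms *)

Lemma qformB (R : realType) n (A B : 'M[R]_n) x :
  qform (A - B) x = qform A x - qform B x.
Proof. by rewrite /qform mulmxBr mulmxBl !mxE. Qed.

Lemma qformN (R : realType) n (A : 'M[R]_n) x : qform (- A) x = - qform A x.
Proof. by rewrite /qform mulmxN mulNmx mxE. Qed.

Lemma qformZ (R : realType) n (a : R) (A : 'M[R]_n) x :
  qform (a *: A) x = a * qform A x.
Proof. by rewrite /qform -scalemxAr -scalemxAl mxE. Qed.

Lemma qform_congr (R : realType) m n (A : 'M[R]_n) (B : 'M[R]_(n, m)) x :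
  qform (B^T *m A *m B) x = qform A (B *m x).
Proof. by rewrite /qform trmx_mul !mulmxA. Qed.

Lemma qform_gram (R : realType) m n (B : 'M[R]_(n, m)) x :
  qform (B^T *m B) x = fnorm (B *m x) ^+ 2.
Proof. by rewrite fnorm_sqr /qform trmx_mul !mulmxA. Qed.

Lemma loewner_le_qform (R : realType) n (A B : 'M[R]_n) x :
  loewner_le A B -> qform A x <= qform B x.
Proof. by case=> _ /(_ x); rewrite qformB subr_ge0. Qed.

(* Young's inequality: expand [0 <= qform M (eta x - y)] and divide by [eta]. *)
Lemma qformD_young (R : realType) n (M : 'M[R]_n) (eta : R) x y :
  psd M -> 0 < eta ->
  qform M (x + y) <= (1 + eta) * qform M x + (1 + eta^-1) * qform M y.
Proof.
move=> [Msym Mge0] eta0.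
pose b : R := (x^T *m M *m y) 0 0.
(* Symmetry of [M] merges the two cross terms. *)
have hb : (y^T *m M *m x) 0 0 = b.
  by rewrite /b -[in RHS]Msym -[in LHS](trmxK (_ *m _ *m x)) mxE !trmx_mul trmxK mulmxA.
have e (s t : R) : qform M (s *: x + t *: y) =
    s ^+ 2 * qform M x + 2 * s * t * b + t ^+ 2 * qform M y.
  rewrite /qform; have -> : (s *: x + t *: y)^T = s *: x^T + t *: y^T.
    by rewrite linearD !linearZ.
  rewrite !(mulmxDl, mulmxDr) -!(scalemxAl, scalemxAr).
  have mE (a c : 'M[R]_1) : (a + c) 0 0 = a 0 0 + c 0 0 by rewrite mxE.
  have mZ (k : R) (a : 'M[R]_1) : (k *: a) 0 0 = k * a 0 0 by rewrite mxE.
  rewrite !(mE, mZ) hb -/b; ring.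
have := Mge0 (eta *: x + (-1) *: y); rewrite e => h.
have := e 1 1; rewrite !scale1r => ->.
rewrite -(ler_pM2l eta0).
have -> : eta * ((1 + eta) * qform M x + (1 + eta^-1) * qform M y) =
  (eta + eta ^+ 2) * qform M x + (eta + 1) * qform M y.
  by field; rewrite gt_eqF.
nra.
Qed.

(** The form is a polynomial in the coordinates of the stacked vector, each of which is a coordinate
    of one of the two projections. *)
Lemma qform_col_mx_continuous (R : realType) m n (M : 'M[R]_(m + n)) :
  continuous (fun s : 'cV[R]_m * 'cV[R]_n => qform M (col_mx s.1 s.2)).
Proof.
have hc (i : 'I_(m + n)) :
    continuous (fun s : 'cV[R]_m * 'cV[R]_n => (col_mx s.1 s.2 : 'cV_(m + n)) i 0).
  move=> s; case: (split_ordP i) => k ->.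
    under eq_fun do rewrite col_mxEu.
    exact: (@cvg_comp _ _ _ _ (fun A : 'cV[R]_m => A k 0) _ _ _ cvg_fst
      (@coord_continuous _ _ _ k 0 _)).
  under eq_fun do rewrite col_mxEd.
  exact: (@cvg_comp _ _ _ _ (fun A : 'cV[R]_n => A k 0) _ _ _ cvg_snd
      (@coord_continuous _ _ _ k 0 _)).
have -> : (fun s : 'cV[R]_m * 'cV[R]_n => qform M (col_mx s.1 s.2)) =
    fun s => \sum_k (\sum_l (col_mx s.1 s.2 : 'cV_(m + n)) l 0 * M l k)
                    * (col_mx s.1 s.2 : 'cV_(m + n)) k 0.
  apply/funext => s; rewrite /qform mxE; apply: eq_bigr => k _.
  by rewrite mxE; congr (_ * _); apply: eq_bigr => l _; rewrite mxE.
apply: continuous_big => [|k _ s]; first exact: add_continuous.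
apply: continuousM; last exact: hc.
apply: continuous_big s => [|l _ t]; first exact: add_continuous.
by apply: continuousM; [exact: hc | exact: cst_continuous].
Qed.

(** * Gradient systems and the bisimulation bound *)

Lemma gradient_system_fixpoint (R : realType) nx nu ny p
    (T : lqg_task R nx nu ny) (S : 'M[R]_(nx, p * (nu + ny)))
    (K : 'M[R]_(nu, p * (nu + ny))) :
  stabilizing T S K ->
  let G := gradient_system T S K in
  sysF G *m vec (Sigma_cl T S K) + sysnu G = vec (Sigma_cl T S K).
Proof.
(* Stability yields a solution, so the [xget] in [Sigma_cl] returns a genuine one and not its
   default 0. *)
move=> /(lyapunov_solvable (Sigma_nu T)) /(xgetPex 0) /= hX.
by rewrite tensmx_vec -vecD addrC; congr vec.
Qed.

Lemma gradient_system_output (R : realType) nx nu ny p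
    (T : lqg_task R nx nu ny) (S : 'M[R]_(nx, p * (nu + ny)))
    (K : 'M[R]_(nu, p * (nu + ny))) :
  sysC (gradient_system T S K) *m vec (Sigma_cl T S K) = vec (gradJ T S K).
Proof. exact: tensmx_vec. Qed.

Lemma bisimulation_fixpoint_le (R : realType) n m (S1 S2 : affine_system R n m)
    (lam zeta : R) V s1 s2 :
  bisimulation_with S1 S2 lam zeta V ->
  sysF S1 *m s1 + sysnu S1 = s1 -> sysF S2 *m s2 + sysnu S2 = s2 ->
  fnorm (sysC S1 *m s1 - sysC S2 *m s2) ^+ 2
    <= zeta * V (sysnu S1, sysnu S2) / lam.
Proof.
move=> [_ _ /andP[lam0 _] _ /(_ s1 s2)[hC]] hF h1 h2; apply: le_trans hC _.
move: hF; rewrite h1 h2 subrr ler_pdivlMr // => h; lra.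
Qed.

(** Young's inequality splits off the input: [V(F s + nu) <= (1 + eta) V(F s) + (1 + eta^-1) V(nu)].
    The contraction gives [V(F s) <= (1 - lam) V(s)], and [(1 + eta) (1 - lam) = 1 - (lam - eta (1 -
    lam))]. *)
Lemma qform_bisimulation (R : realType) n m (S1 S2 : affine_system R n m)
    (M : 'M[R]_(n + n)) (lam eta : R) :
  psd M -> 0 < lam < 1 ->
  loewner_le ((joint_C S1 S2)^T *m joint_C S1 S2) M ->
  loewner_le ((joint_F S1 S2)^T *m M *m joint_F S1 S2 - M) (- (lam *: M)) ->
  0 < eta < lam / (1 - lam) ->
  bisimulation_with S1 S2 (lam - eta * (1 - lam)) (1 + eta^-1)
    (fun s => qform M (col_mx s.1 s.2)).
Proof.
move=> Mpsd /andP[lam0 lam1] hC hF /andP[eta0].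
have lam1' : 0 < 1 - lam by rewrite subr_gt0.
rewrite ltr_pdivlMr // => eta_lt.
split.
- exact: qform_col_mx_continuous.
- by move=> s; apply: Mpsd.2.
(* The upper bound on [eta] is exactly positivity of the new rate, which moreover stays below
   [lam < 1]. *)
- apply/andP; split; nra.
- by rewrite ltr_wpDl // invr_gt0.
move=> s1 s2 /=; split.
  have := loewner_le_qform (col_mx s1 s2) hC.
  by rewrite qform_gram /joint_C mul_row_col mulNmx.
have := loewner_le_qform (col_mx s1 s2) hF.
rewrite qformB qformN qformZ qform_congr /joint_F.
rewrite mul_block_col !mul0mx addr0 add0r => h.
rewrite -add_col_mx.
have := qformD_young (col_mx (sysF S1 *m s1) (sysF S2 *m s2))
  (col_mx (sysnu S1) (sysnu S2)) Mpsd eta0.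
nra.
Qed.

Theorem mainTheorem1 (R : realType) (nx nu ny p N : nat)
    (T : 'I_N -> lqg_task R nx nu ny)
    (S : 'I_N -> 'M[R]_(nx, p * (nu + ny)))
    (hS : forall i, is_history_lift (T i) (S i))
    (K : 'M[R]_(nu, p * (nu + ny)))
    (hK : forall i, stabilizing (T i) (S i) K)
    (i j : 'I_N) (hij : i != j)
    (M : 'M[R]_(nx * nx + nx * nx)) (lam eta : R) :
  let Si := gradient_system (T i) (S i) K in
  let Sj := gradient_system (T j) (S j) K in
  let Cij := joint_C Si Sj in
  let Fij := joint_F Si Sj in
  let nuij := joint_nu Si Sj in
  let zeta := 1 + eta^-1 in
  let lam' := lam - eta * (1 - lam) in
  let V := fun s : 'cV[R]_(nx * nx) * 'cV[R]_(nx * nx) =>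
             qform M (col_mx s.1 s.2) in
  psd M -> 0 < lam < 1 ->
  loewner_le (Cij^T *m Cij) M ->
  loewner_le (Fij^T *m M *m Fij - M) (- (lam *: M)) ->
  0 < eta < lam / (1 - lam) ->
  [/\ bisimulation_function Si Sj V,
      bisimulation_with Si Sj lam' zeta V
    & gradient_heterogeneity (T i) (T j) (S i) (S j) K
        <= zeta * qform M nuij / lam'].
Proof.
move=> Si Sj Cij Fij nuij zeta lam' V Mpsd hlam hC hF heta.
have hV := qform_bisimulation Mpsd hlam hC hF heta.
split=> //; first by exists lam', zeta.
have := bisimulation_fixpoint_le hV (gradient_system_fixpoint (hK i))
  (gradient_system_fixpoint (hK j)).
(* At the fixed points the outputs are the vectorised gradients, and [vec] preserves the Frobenius
   norm of their difference. *)
by rewrite !gradient_system_output -vecB fnorm_vec.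
Qed.
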